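(* Let $1\le k\le n$, let $\mathcal S\subset\mathcal P_n$ be the stabilizer group of a stabilizer code with logical Pauli group $\mathcal L$, and let $\tilde G\subset\tilde{\mathcal P}_n$ be a nontrivial subgroup. Let $p\in[0,1)$, $z=p/(3-3p)$, $p_{\rm DD},p_{\rm QED}\in[0,1]$, and write $W(A)=W(A;z)$. For the hybrid LDD+QED protocol described in the context, put $$Q_{\rm Hyb}=(1-p_{\rm QED})\bigl(W(N\cap U)+p_{\rm DD}W(N\cap V)\bigr)+2^{k-n}p_{\rm QED}\bigl(W(U)+p_{\rm DD}W(V)\bigr).$$ Then the entanglement infidelity conditioned on acceptance is $$1-F_{\rm HybD}=Q_{\rm Hyb}^{-1}\Bigl[\bigl(1-p_{\rm QED}(1-2^{k-n})\bigr)\bigl(W((N\setminus T)\cap U)+p_{\rm DD}W((N\setminus T)\cap V)\bigr)+(1-4^{-k})2^{k-n}p_{\rm QED}\bigl(W(U\setminus N)+p_{\rm DD}W(V\setminus N)\bigr)\Bigr],$$ and the acceptance probability is $$P_{A,{\rm Hyb}}=\frac{Q_{\rm Hyb}}{W(U)+p_{\rm DD}W(V)}.$$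
   Context: Paulis. $\mathcal P_n$ is the $n$-qubit Pauli group (with phases $\pm1,\pm i$), $\tilde{\mathcal P}_n=\mathcal P_n/\langle iI\rangle$, and $\pi:\mathcal P_n\to\tilde{\mathcal P}_n$ is the projection. Elements of $\tilde{\mathcal P}_n$ are represented by strings in $\{I,X,Y,Z\}^n$; $\mathrm{wt}(E')$ is the number of non-identity letters. Two elements of $\tilde{\mathcal P}_n$ are said to commute (anticommute) if their representatives in $\mathcal P_n$ do. Code. $\mathcal S\subset\mathcal P_n$ is a subgroup with $2^{n-k}$ elements not containing $-I$. $C(\mathcal S)$ is its centralizer in $\mathcal P_n$. $\mathcal L\subseteq C(\mathcal S)$ is a subgroup with $C(\mathcal S)=\mathcal S\mathcal L$ and $\pi(\mathcal S)\cap\pi(\mathcal L)=\{\pi(I)\}$. $\mathcal S^*$ is the $\mathbb F_2$-dual of $\mathcal S$ (it has $2^{n-k}$ elements); the syndrome $\mathrm{syn}(E')\in\mathcal S^*$ is given by $\mathrm{syn}(E')(s)=1$ iff $E'$ anticommutes with $s$. Sets. $T=\pi(\mathcal S)$ (stabilizers); $N=\pi(\mathcal S\mathcal L)=\pi(C(\mathcal S))$ (zero-syndrome errors); $U=\tilde G^\perp=\{E'\in\tilde{\mathcal P}_n: E'\text{ commutes with every element of }\tilde G\}$ (unsuppressed errors); $V=\tilde{\mathcal P}_n\setminus U$ (suppressed errors). For $A\subset\tilde{\mathcal P}_n$, $W(A;z)=\sum_{E'\in A}z^{\mathrm{wt}(E')}$. Hybrid LDD+QED protocol. A random error $E'\in\tilde{\mathcal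 P}_n$ is drawn from the distribution obtained from $(1-p)^{n-\mathrm{wt}(E')}(p/3)^{\mathrm{wt}(E')}$ by multiplying the probabilities of all $E'\in V$ by $p_{\rm DD}$ and renormalizing. Independently, with probability $1-p_{\rm QED}$ the reported syndrome is the true one $\mathrm{syn}(E')$, and with probability $p_{\rm QED}$ it is uniformly random in $\mathcal S^*$. The run is accepted iff the reported syndrome is $0$. On an accepted run the induced logical Pauli class in $N/T$ is the class of $E'$ if $E'\in N$, and is uniformly random among the $4^k$ classes if $E'\notin N$. $P_{A,{\rm Hyb}}$ is the probability of acceptance and $F_{\rm HybD}$ is the conditional probability, given acceptance, that the logical class is trivial (this is the entanglement fidelity conditioned on acceptance). *)

(* Defs.v *)
From HB Require Import structures.
From mathcomp Require Import all_boot all_order all_fingroup all_algebra.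
From mathcomp Require Import ring.

Set Implicit Arguments.
Unset Strict Implicit.
Unset Printing Implicit Defensive.

Import Order.TTheory GRing.Theory Num.Theory.
Local Open Scope ring_scope.

Variant letter := PI | PX | PY | PZ.

Definition letter_code (a : letter) : bool * bool :=
  match a with
  | PI => (false, false) | PX => (true, false)
  | PY => (true, true) | PZ => (false, true)
  end.

Definition letter_decode (x : bool * bool) : letter :=
  match x with
  | (false, false) => PI | (true, false) => PX
  | (true, true) => PY | (false, true) => PZ
  end.

Fact letter_codeK : cancel letter_code letter_decode.
Proof. by case. Qed.

HB.instance Definition _ := Finite.copy letter (can_type letter_codeK).

Definition letter_mul (a b : letter) : letter :=
  match a, b with
  | PI, c | c, PI => c
  | PX, PX | PY, PY | PZ, PZ => PI
  | PX, PY | PY, PX => PZ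
  | PY, PZ | PZ, PY => PX
  | PZ, PX | PX, PZ => PY
  end.

(* [a b = i ^ letter_phase a b * letter_mul a b]: XY = iZ, YX = -iZ, etc. *)
Definition letter_phase (a b : letter) : 'Z_4 :=
  match a, b with
  | PX, PY | PY, PZ | PZ, PX => 1
  | PY, PX | PZ, PY | PX, PZ => -1
  | _, _ => 0
  end.

Fact letter_mulA : associative letter_mul.
Proof. by do 3!case. Qed.

Fact letter_mul1 : left_id PI letter_mul.
Proof. by case. Qed.

Fact letter_mulV : left_inverse PI id letter_mul.
Proof. by case. Qed.

HB.instance Definition _ :=
  Finite_isGroup.Build letter letter_mulA letter_mul1 letter_mulV.

Fact letter_phaseA (a b c : letter) :
  letter_phase b c + letter_phase a (b * c)%g
    = letter_phase a b + letter_phase (a * b)%g c.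
Proof. by case: a; case: b; case: c; apply/val_inj. Qed.

(* Joins the finite and group structures of finite functions. *)
HB.saturate finfun_of.

(* The phase-free group, with pointwise product: strings of letters represent
   the Pauli group modulo its phases (see [ker_pauli_pi]). *)
Notation pstr n := {ffun 'I_n -> letter}.

Lemma pstr1 (n : nat) (i : 'I_n) : (1%g : pstr n) i = PI.
Proof. by rewrite ffunE. Qed.

Lemma pstrM (n : nat) (E F : pstr n) (i : 'I_n) : (E * F)%g i = (E i * F i)%g.
Proof. by rewrite ffunE. Qed.

Definition wt (n : nat) (E : pstr n) : nat := #|[set i | E i != PI]|.

(* [Pauli a E] is the operator i^a E_1 (x) ... (x) E_n. *)
Record pauli (n : nat) := Pauli { phase : 'Z_4; letters : pstr n }.

Definition pauli_code (n : nat) (g : pauli n) : 'Z_4 * pstr n :=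
  (phase g, letters g).

Definition pauli_decode (n : nat) (x : 'Z_4 * pstr n) : pauli n :=
  Pauli x.1 x.2.

Fact pauli_codeK (n : nat) : cancel (@pauli_code n) (@pauli_decode n).
Proof. by case. Qed.

HB.instance Definition _ (n : nat) :=
  Finite.copy (pauli n) (can_type (@pauli_codeK n)).

Definition pauli_mul (n : nat) (g h : pauli n) : pauli n :=
  Pauli
    (phase g + phase h + \sum_(i < n) letter_phase (letters g i) (letters h i))
    (letters g * letters h)%g.

Definition pauli_one (n : nat) : pauli n := Pauli 0 1%g.

Definition pauli_inv (n : nat) (g : pauli n) : pauli n :=
  Pauli (- phase g) (letters g).

Fact pauli_mulA (n : nat) : associative (@pauli_mul n).
Proof.
move=> g h l; congr Pauli; rewrite /= ?mulgA //.
set p := \sum_(i < n) letter_phase (letters h i) _.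
set q := \sum_(i < n) letter_phase (letters g i) ((letters h * letters l)%g i).
set r := \sum_(i < n) letter_phase (letters g i) (letters h i).
set s := \sum_(i < n) _.
have E : p + q = r + s.
  rewrite -!big_split; apply: eq_bigr => i _.
  by rewrite !pstrM; exact: letter_phaseA.
have -> : q = r + s - p by rewrite -E addrC addKr.
by ring.
Qed.

Fact pauli_mul1 (n : nat) : left_id (pauli_one n) (@pauli_mul n).
Proof.
case=> a E; congr Pauli; rewrite /= ?mul1g // add0r big1 ?addr0 // => i _.
by rewrite pstr1.
Qed.

Fact pauli_mulV (n : nat) :
  left_inverse (pauli_one n) (@pauli_inv n) (@pauli_mul n).
Proof.
case=> a E; congr Pauli; rewrite /=.
  by rewrite addNr add0r big1 // => i _; case: (E i).
by apply/ffunP => i; rewrite pstrM pstr1; case: (E i).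
Qed.

HB.instance Definition _ (n : nat) :=
  Finite_isGroup.Build (pauli n)
    (@pauli_mulA n) (@pauli_mul1 n) (@pauli_mulV n).

Definition iI (n : nat) : pauli n := Pauli 1 1%g.
Definition mI (n : nat) : pauli n := Pauli 2 1%g.

Definition pauli_pi (n : nat) (g : pauli n) : pstr n := letters g.

Fact pauli_piM (n : nat) :
  {in [set: pauli n] &, {morph @pauli_pi n : g h / (g * h)%g}}.
Proof. by []. Qed.

Canonical pauli_pi_morphism (n : nat) := Morphism (@pauli_piM n).

Definition pauli_lift (n : nat) (E : pstr n) : pauli n := Pauli 0 E.

(* Commutation in the phase-free group is commutation of representatives;
   it does not depend on their choice (see [pcommP] and [panticommP]). *)
Definition pcomm (n : nat) (E F : pstr n) : bool :=
  (pauli_lift E * pauli_lift F == pauli_lift F * pauli_lift E)%g.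

Definition panticomm (n : nat) (E F : pstr n) : bool :=
  (pauli_lift E * pauli_lift F == mI n * (pauli_lift F * pauli_lift E))%g.

Lemma pauli_piT (n : nat) : (pauli_pi_morphism n @* [set: pauli n])%g = [set: pstr n].
Proof.
apply/setP => E; rewrite !inE.
by apply/morphimP; exists (pauli_lift E); rewrite ?inE.
Qed.

Lemma iI_exp (n m : nat) : (iI n ^+ m)%g = Pauli m%:R 1%g.
Proof.
elim: m => [|m IHm]; first by rewrite expg0.
rewrite expgS IHm; congr Pauli; rewrite /= ?mulg1 //.
by rewrite big1 ?addr0 -?natr1 1?addrC // => i _; rewrite !pstr1.
Qed.

Lemma ker_pauli_pi (n : nat) : ('ker (pauli_pi_morphism n))%g = <[iI n]>%g.
Proof.
apply/setP => -[a E]; apply/kerP/cycleP; rewrite ?inE //.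
  by move=> /= E1; exists a; rewrite iI_exp natr_Zp; congr Pauli.
by case=> m; rewrite iI_exp => -[_ ->].
Qed.

Lemma pauli_eqE (n : nat) (g h : pauli n) :
  (g == h) = (phase g == phase h) && (letters g == letters h).
Proof. exact: esym (inj_eq (can_inj (@pauli_codeK n)) g h). Qed.

Lemma pcommP (n : nat) (g h : pauli n) :
  pcomm (pauli_pi g) (pauli_pi h) = (g * h == h * g)%g.
Proof.
rewrite /pcomm !pauli_eqE /= !add0r [phase h + _]addrC; congr andb.
exact: esym (inj_eq (addrI _) _ _).
Qed.

Lemma panticommP (n : nat) (g h : pauli n) :
  panticomm (pauli_pi g) (pauli_pi h) = (g * h == mI n * (h * g))%g.
Proof.
rewrite /panticomm !pauli_eqE /= !add0r [phase h + _]addrC; congr andb.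
rewrite [2 + (_ + _ + _)]addrCA -[_ + (2 + _) + _]addrA.
exact: esym (inj_eq (addrI _) _ _).
Qed.

Definition letter_mx (C : numClosedFieldType) (a : letter) : 'M[C]_2 :=
  match a with
  | PI => 1%:M
  | PX => \matrix_(r, c) (r != c)%:R
  | PY => \matrix_(r, c) (if r == c then 0 else if c == 0 then 'i else - 'i)
  | PZ => \matrix_(r, c) (if r == c then if c == 0 then 1 else - 1 else 0)
  end.

Lemma letter_mxM (C : numClosedFieldType) (a b : letter) :
  letter_mx C a *m letter_mx C b
    = 'i ^+ letter_phase a b *: letter_mx C (letter_mul a b).
Proof.
have ii : 'i * 'i = -1 :> C by rewrite -expr2 sqrCi.
have i3 : 'i ^+ 3 = - 'i :> C by rewrite exprS sqrCi mulrN1.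
case: a; case: b => /=; rewrite ?(mul1mx, mulmx1, expr0, scale1r) //;
apply/matrixP => r c; rewrite !mxE !big_ord_recr big_ord0 /= !mxE;
case: r => [[|[|//]] ?]; case: c => [[|[|//]] ?];
rewrite -!val_eqE /= ?i3 ?expr1; rewrite ?(mul0r,mulr0,add0r,addr0,mul1r,mulr1,mulrN,mulNr,ii,opprK) //.
Qed.

(* Entry (x, y) of i^a E_1 (x) ... (x) E_n in the computational basis. *)
Definition pauli_entry (C : numClosedFieldType) (n : nat) (g : pauli n)
    (x y : {ffun 'I_n -> 'I_2}) : C :=
  'i ^+ phase g * \prod_(i < n) letter_mx C (letters g i) (x i) (y i).


Lemma pauli_entryM (C : numClosedFieldType) (n : nat) (g h : pauli n)
    (x y : {ffun 'I_n -> 'I_2}) :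
  pauli_entry C (g * h)%g x y
    = \sum_(z : {ffun 'I_n -> 'I_2}) pauli_entry C g x z * pauli_entry C h z y.
Proof.
have i4 : 'i ^+ 4 = 1 :> C by rewrite (exprM _ 2 2) sqrCi sqrrN expr1n.
have iD (a b : 'Z_4) : 'i ^+ (a + b : 'Z_4)%R = 'i ^+ a * 'i ^+ b :> C.
  by rewrite -exprD -(expr_mod (a + b)%N i4).
have isum (F : 'I_n -> 'Z_4) :
    'i ^+ (\sum_(i < n) F i : 'Z_4)%R = \prod_(i < n) 'i ^+ F i :> C.
  have i0 : 'i ^+ (0%R : 'Z_4) = 1 :> C by [].
  exact: (big_morph (fun a : 'Z_4 => 'i ^+ a : C) iD i0).
rewrite /pauli_entry.
have -> : phase (g * h)%g = phase g + phase h
    + \sum_(i < n) letter_phase (letters g i) (letters h i) by [].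
have -> : letters (g * h)%g = (letters g * letters h)%g by [].
rewrite !iD isum -mulrA -big_split /=.
under eq_bigr => i _.
  rewrite pstrM.
  have := letter_mxM C (letters g i) (letters h i).
  move/matrixP/(_ (x i) (y i)); rewrite !mxE => <-; over.
rewrite bigA_distr_bigA mulr_sumr; apply: eq_bigr => z _ /=.
by rewrite big_split /= mulrACA.
Qed.

Definition stabilizers (n : nat) (S : {set pauli n}) : {set pstr n} :=
  (pauli_pi_morphism n @* S)%g.

Definition zero_syndrome (n : nat) (S L : {set pauli n}) : {set pstr n} :=
  (pauli_pi_morphism n @* (S * L))%g.

Definition unsuppressed (n : nat) (G : {set pstr n}) : {set pstr n} :=
  [set E | [forall F in G, pcomm E F]].

Definition suppressed (n : nat) (G : {set pstr n}) : {set pstr n} :=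
  ~: unsuppressed G.

Definition enumerator (R : pzSemiRingType) (n : nat) (A : {set pstr n})
    (z : R) : R :=
  \sum_(E in A) z ^+ wt E.

(* The F_2-dual of S: homomorphisms from S to the additive group of F_2. *)
Notation syndromes S := {ffun [subg S] -> 'F_2}.

Definition dual (n : nat) (S : {group pauli n}) : {set syndromes S} :=
  [set f : syndromes S | [forall s, forall t, f (s * t)%g == f s + f t]].

Definition syn (n : nat) (S : {group pauli n}) (E : pstr n) : syndromes S :=
  [ffun s => (panticomm E (pauli_pi (sgval s)))%:R].

(* Probabilities on finite types are given by their mass functions. *)
Definition prob (R : pzSemiRingType) (T : finType) (mu : T -> R)
    (A : {pred T}) : R :=
  \sum_(x in A) mu x.

Definition cond_prob (R : fieldType) (T : finType) (mu : T -> R)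
    (A B : {pred T}) : R :=
  prob mu [predI A & B] / prob mu B.

Definition bernoulli (R : pzRingType) (q : R) (b : bool) : R :=
  if b then q else 1 - q.

Definition uniform (R : fieldType) (T : finType) (A : {set T}) (x : T) : R :=
  if x \in A then #|A|%:R^-1 else 0.

Definition depolarizing (R : fieldType) (n : nat) (p : R) (E : pstr n) : R :=
  (1 - p) ^+ (n - wt E) * (p / 3) ^+ wt E.

Definition dd_weight (R : fieldType) (n : nat) (G : {set pstr n}) (p pDD : R)
    (E : pstr n) : R :=
  depolarizing p E * (if E \in suppressed G then pDD else 1).

Definition dd_error (R : fieldType) (n : nat) (G : {set pstr n}) (p pDD : R)
    (E : pstr n) : R :=
  dd_weight G p pDD E / \sum_F dd_weight G p pDD F.

(* A run draws independently the error, whether the syndrome report is faulty,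
   the syndrome reported in the faulty case, and the logical class assigned to
   an error with non-zero true syndrome. *)
Notation run S :=
  (pstr _ * bool * syndromes S * coset_of (stabilizers S))%type.

Definition hyb_law (R : fieldType) (n : nat) (S L : {group pauli n})
    (G : {set pstr n}) (p pDD pQED : R) (w : run S) : R :=
  let: (E, faulty, f, c) := w in
  dd_error G p pDD E * bernoulli pQED faulty * uniform R (dual S) f
    * uniform R (zero_syndrome S L / stabilizers S)%g c.

Definition reported (n : nat) (S : {group pauli n}) (w : run S) : syndromes S :=
  let: (E, faulty, f, _) := w in if faulty then f else syn S E.

Definition logical_class (n : nat) (S L : {group pauli n}) (w : run S) :
    coset_of (stabilizers S) :=
  let: (E, _, _, c) := w in
  if E \in zero_syndrome S L then coset (stabilizers S) E else c.

Definition accepted (n : nat) (S : {group pauli n}) : {pred run S} :=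
  [pred w | reported w == 0].

Definition logically_trivial (n : nat) (S L : {group pauli n}) : {pred run S} :=
  [pred w | logical_class L w == 1%g].

Definition P_A_Hyb (R : fieldType) (n : nat) (S L : {group pauli n})
    (G : {set pstr n}) (p pDD pQED : R) : R :=
  prob (hyb_law L G p pDD pQED) (@accepted n S).

Definition F_HybD (R : fieldType) (n : nat) (S L : {group pauli n})
    (G : {set pstr n}) (p pDD pQED : R) : R :=
  cond_prob (hyb_law L G p pDD pQED)
    (@logically_trivial n S L) (@accepted n S).

(* Main.v *)
(* The pairing [panticomm] on strings of letters is the sum mod 2 of a
   letterwise pairing, hence bilinear and nondegenerate.  Summing the signs
   (-1)^<E,s> over all pairs in the two possible orders gives |S| |N| = 4^n, and
   the same argument for the evaluation pairing gives |S^*| = |S|.  Hence a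
   faulty report is 0 with probability 2^(k-n), and |N/T| = 4^n / |S|^2 = 4^k.
   Given the error E, a run is accepted with probability
   (1 - pQED) [E in N] + 2^(k-n) pQED, and independently its class is trivial
   with probability [E in T] if E is in N and 4^-k otherwise; the depolarizing
   weight of E being (1 - p)^n z^(wt E), summing over E gives both formulas.
   The identity is in N and U, so Q > 0. *)

Require Import Defs.
From mathcomp Require Import all_boot all_order all_fingroup all_algebra.
From mathcomp Require Import ring lra.

Set Implicit Arguments.
Unset Strict Implicit.
Unset Printing Implicit Defensive.

Import Order.TTheory GRing.Theory Num.Theory.
Local Open Scope ring_scope.

(** * The commutation pairing on strings of letters *)

Lemma card_letter : #|{: letter}| = 4%N.
Proof.
have code_bij : bijective letter_code.
  by apply: (Bijective letter_codeK); do 3!case.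
by rewrite (bij_eq_card code_bij) card_prod card_bool.
Qed.

(** The symplectic form of F_2^2, read on letters through [letter_code]. *)
Definition letter_anticomm (a b : letter) : bool :=
  [&& a != PI, b != PI & a != b].

Lemma letter_anticommMl (a b c : letter) :
  letter_anticomm (a * b)%g c = letter_anticomm a c (+) letter_anticomm b c.
Proof. by case: a; case: b; case: c. Qed.

Lemma letter_anticommC (a b : letter) :
  letter_anticomm a b = letter_anticomm b a.
Proof. by case: a; case: b. Qed.

Lemma letter_phaseC (a b : letter) :
  letter_phase a b = (if letter_anticomm a b then 2 else 0) + letter_phase b a.
Proof. by case: a; case: b; apply/val_inj. Qed.

(** Each anticommuting position shifts the exponent of i by 2, and 2 + 2 = 0 in Z_4, so only the
    parity of their number survives. *)
Lemma sum_letter_phaseC (n : nat) (E F : pstr n) :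
  \sum_(i < n) letter_phase (E i) (F i)
    = (if \big[addb/false]_(i < n) letter_anticomm (E i) (F i) then 2 else 0)
      + \sum_(i < n) letter_phase (F i) (E i).
Proof.
rewrite (big_morph (fun b : bool => if b then 2 else 0 : 'Z_4) (id1 := 0)
  (op1 := +%R)) //; last by do 2!case; apply/val_inj.
by rewrite -big_split; apply: eq_bigr => i _; exact: letter_phaseC.
Qed.

Lemma pstr_mulC (n : nat) (E F : pstr n) : (E * F = F * E)%g.
Proof. by apply/ffunP => i; rewrite !pstrM; case: (E i); case: (F i). Qed.

Lemma pstr_norm (n : nat) (A B : {set pstr n}) : (A \subset 'N(B))%g.
Proof. by apply/cents_norm/centsP => E _ F _; exact: pstr_mulC. Qed.

Lemma panticommE (n : nat) (E F : pstr n) :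
  panticomm E F = \big[addb/false]_(i < n) letter_anticomm (E i) (F i).
Proof.
rewrite /panticomm pauli_eqE /= [(F * E)%g]pstr_mulC mul1g eqxx andbT !add0r.
rewrite [X in _ + X]big1 ?addr0 => [|i _]; last by rewrite pstr1.
rewrite sum_letter_phaseC (inj_eq (addIr _)).
by case: (\big[_/_]_(i < n) _).
Qed.

(** The two products have the same letters, and their phases differ by 0 or 2, so no third case
    arises. *)
Lemma pcommE (n : nat) (E F : pstr n) : pcomm E F = ~~ panticomm E F.
Proof.
rewrite panticommE /pcomm pauli_eqE /= [(F * E)%g]pstr_mulC eqxx andbT !add0r.
rewrite sum_letter_phaseC -[X in _ == X]add0r (inj_eq (addIr _)).
by case: (\big[_/_]_(i < n) _).
Qed.

Lemma panticommC (n : nat) (E F : pstr n) : panticomm E F = panticomm F E.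
Proof.
by rewrite !panticommE; apply: eq_bigr => i _; exact: letter_anticommC.
Qed.

Lemma panticommMl (n : nat) (E E' F : pstr n) :
  panticomm (E * E')%g F = panticomm E F (+) panticomm E' F.
Proof.
rewrite !panticommE -big_split; apply: eq_bigr => i _.
by rewrite pstrM letter_anticommMl.
Qed.

Lemma panticommMr (n : nat) (E F F' : pstr n) :
  panticomm E (F * F')%g = panticomm E F (+) panticomm E F'.
Proof. by rewrite panticommC panticommMl !(panticommC E). Qed.

Lemma panticomm1r (n : nat) (E : pstr n) : panticomm E 1%g = false.
Proof. by have := panticommMr E 1%g 1%g; rewrite mulg1; case: panticomm. Qed.

Lemma panticomm_nondegenerate (n : nat) (F : pstr n) :
  F != 1%g -> exists E : pstr n, panticomm E F.
Proof.
move=> F1; have [i Fi] : exists i, F i != PI.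
  apply/existsP; apply: contraNT F1 => /existsPn F1; apply/eqP/ffunP => i.
  by rewrite pstr1; apply/eqP; have := F1 i; rewrite negbK.
(* A letter anticommuting with [F i]: Z against X, and X against Y or Z. The witness is the identity
   elsewhere. *)
pose a := if F i == PX then PZ else PX.
exists [ffun j => if j == i then a else PI]; rewrite panticommE (bigD1 i) //=.
rewrite ffunE eqxx big1 => [|j /negPf ji]; last by rewrite ffunE ji.
by rewrite /a; case: (F i) Fi.
Qed.

(** * Counting by sums of signs *)

(** Reindexing by [t] flips every sign, so the sum equals its opposite. *)
Lemma sum_sign_eq0 (T : finType) (A : {pred T}) (f : T -> bool) (t : T -> T) :
    injective t -> (forall x, (t x \in A) = (x \in A)) ->
    {in A, forall x, f (t x) = ~~ f x} ->
  \sum_(x in A) (-1) ^+ f x = 0 :> int.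
Proof.
move=> t_inj tA ft; set s := \sum_(x in A) _.
have : s = - s.
  rewrite {1}/s (reindex_inj t_inj) /= -sumrN.
  apply: eq_big => [x|x]; rewrite tA //.
  by move=> xA; rewrite ft // signrN.
by move/eqP; rewrite -addr_eq0 -mulr2n mulrn_eq0 => /eqP.
Qed.

(** The double sum of signs is evaluated in both orders: summing over [A] first leaves only [y0],
    which gives #|A|; summing over [B] first leaves #|B| for each [x] that annihilates [B]. *)
Lemma card_annihilator (T T' : finType) (A : {set T}) (B : {set T'})
    (e : T -> T' -> bool) (y0 : T') :
    y0 \in B -> {in A, forall x, e x y0 = false} ->
    {in B, forall y, y != y0 -> \sum_(x in A) (-1) ^+ e x y = 0 :> int} ->
    {in A & B, forall x y, e x y -> \sum_(y' in B) (-1) ^+ e x y' = 0 :> int} ->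
  #|A| = (#|B| * #|[set x in A | [forall y in B, ~~ e x y]]|)%N.
Proof.
move=> By0 e0 sumA sumB; apply/eqP; rewrite -(eqr_nat int) natrM.
have -> : #|A|%:R = \sum_(y in B) \sum_(x in A) (-1) ^+ e x y :> int.
  rewrite (bigD1 y0) //= [X in _ + X]big1 ?addr0; last first.
    by move=> y /andP[]; exact: sumA.
  by rewrite -sumr_const; apply: eq_bigr => x /e0 ->.
rewrite exchange_big mulr_natr -[_ *+ #|[set _ in _ | _]|]sumr_const /=.
under [X in _ == X]eq_bigl do rewrite inE.
rewrite big_mkcondr /=.
apply/eqP/eq_bigr => x Ax.
case: ifPn => [/'forall_implyP e1|/forall_inPn[y By]].
  by rewrite -sumr_const; apply: eq_bigr => y /e1/negPf ->.
by rewrite negbK; exact: sumB.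
Qed.

(** * Cardinalities attached to the stabilizer group *)

Lemma pauli_sqr (n : nat) (g : pauli n) :
  (g * g)%g = Pauli (phase g + phase g) 1%g.
Proof.
congr Pauli; first by rewrite big1 ?addr0 // => i _; case: (letters g i).
by apply/ffunP => i; rewrite pstrM pstr1; case: (letters g i).
Qed.

Section Stabilizer.
Variables (n : nat) (S : {group pauli n}).
Hypothesis mIS : mI n \notin S.

(** A nontrivial phase in [S] would put -I there: it is -I itself, or its square is. *)
Lemma stabilizer_pi_eq1 (g : pauli n) : g \in S -> pauli_pi g = 1%g -> g = 1%g.
Proof.
case: g => a E gS /= E1; rewrite {}E1 in gS *.
have := groupM gS gS; rewrite pauli_sqr /=.
case: a gS => [[|[|[|[|//]]]] lt_a] gS.
- by move=> _; congr Pauli; apply/val_inj.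
- by rewrite (_ : Pauli _ _ = mI n) ?(negPf mIS) //; congr Pauli; apply/val_inj.
- case/negP: mIS; rewrite (_ : mI n = Pauli (Ordinal lt_a) 1%g) //.
  by congr Pauli; apply/val_inj.
- by rewrite (_ : Pauli _ _ = mI n) ?(negPf mIS) //; congr Pauli; apply/val_inj.
Qed.

Lemma card_stabilizers : #|stabilizers S| = #|S|.
Proof.
rewrite /stabilizers morphimEsub ?subsetT //.
apply: card_in_imset => g h gS hS gh.
apply/eqP; rewrite eq_mulVg1; apply/eqP/stabilizer_pi_eq1.
  by rewrite groupM ?groupV.
rewrite -[pauli_pi _]/(pauli_pi_morphism n _) morphM ?inE // morphV ?inE //=.
by rewrite gh mulVg.
Qed.

Lemma panticomm_stabilizer (s : pauli n) :
  s \in S -> s != 1%g -> exists E, panticomm E (pauli_pi s).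
Proof.
move=> sS s1; apply: panticomm_nondegenerate.
by apply: contraNneq s1 => /(stabilizer_pi_eq1 sS) ->.
Qed.

Lemma zero_syndromeE (L : {group pauli n}) (E : pstr n) :
    ('C(S) = S * L)%g ->
  (E \in zero_syndrome S L) = [forall s in S, ~~ panticomm E (pauli_pi s)].
Proof.
move=> hSL; rewrite /zero_syndrome -hSL.
apply/morphimP/'forall_implyP => [[g _ /centP gS ->] s sS|ES].
  by rewrite -pcommE pcommP; apply/eqP; exact: gS.
exists (pauli_lift E); rewrite ?inE //; apply/centP => s sS.
by apply/eqP; rewrite -pcommP pcommE; exact: ES.
Qed.

Lemma syn_eq0 (L : {group pauli n}) (E : pstr n) :
  ('C(S) = S * L)%g -> (syn S E == 0) = (E \in zero_syndrome S L).
Proof.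
move=> hSL; rewrite (zero_syndromeE _ hSL).
apply/eqP/'forall_implyP => [E0 s sS|E0].
  have := congr1 (fun f : syndromes S => f (subg S s)) E0.
  by rewrite !ffunE subgK //; case: panticomm.
by apply/ffunP => s; rewrite !ffunE (negPf (E0 _ (subgP s))).
Qed.

(** [zero_syndrome S L] is the annihilator of [S] among all strings. Sums over strings vanish after
    translation by a string anticommuting with [s], sums over [S] after translation by an element
    anticommuting with [E]. *)
Lemma card_zero_syndrome (L : {group pauli n}) :
  ('C(S) = S * L)%g -> (#|S| * #|zero_syndrome S L| = 4 ^ n)%N.
Proof.
move=> hSL.
have -> : (4 ^ n = #|[set: pstr n]|)%N.
  by rewrite cardsT card_ffun card_ord card_letter.
rewrite (@card_annihilator _ _ setT S
  (fun E s => panticomm E (pauli_pi s)) 1%g) //.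
- by congr (_ * _)%N; apply: eq_card => E; rewrite !inE zero_syndromeE.
- by move=> E _; exact: panticomm1r.
- move=> s sS /(panticomm_stabilizer sS)[E Es].
  apply: (sum_sign_eq0 (t := mulg E)) => [|F|F _]; rewrite ?inE //.
    exact: mulgI.
  by rewrite panticommMl Es.
move=> E s _ sS Es; apply: (sum_sign_eq0 (t := mulg s)) => [|t|t _].
- exact: mulgI.
- by rewrite groupMl.
by rewrite pauli_piM ?inE // panticommMr Es.
Qed.

Lemma F2_neq0D (a b : 'F_2) : (a + b != 0) = (a != 0) (+) (b != 0).
Proof. by case: a => [[|[|//]] ?]; case: b => [[|[|//]] ?]. Qed.

(** Under evaluation only the zero functional annihilates all of [S]. Elements of [S] other than 1
    are detected by functionals of the form [syn S E], by nondegeneracy of the commutation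
    pairing. *)
Lemma card_dual : #|dual S| = #|S|.
Proof.
have dualP (f : syndromes S) :
    reflect {morph f : s t / (s * t)%g >-> s + t} (f \in dual S).
  rewrite inE; apply: (iffP 'forall_forallP) => f_morph s t; apply/eqP.
    exact: f_morph.
  exact: f_morph.
have syn_dual E : syn S E \in dual S.
  apply/dualP => s t; rewrite !ffunE -[sgval (s * t)%g]/(sgval s * sgval t)%g.
  by rewrite pauli_piM ?inE // panticommMr; do 2!case: panticomm; apply/val_inj.
have sgval1 (s : [subg S]) : s != 1%g -> sgval s != 1%g.
  by rewrite -(inj_eq val_inj).
rewrite (@card_annihilator _ _ (dual S) [set: [subg S]]
  (fun f s => f s != 0) 1%g) //.
- rewrite cardsT card_sub (eq_card (B := S)) // -[RHS]muln1; congr (_ * _)%N.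
  apply/eqP/cards1P; exists 0; apply/setP => f; rewrite !inE.
  apply/andP/eqP => [[_ /forallP f0]|->].
    by apply/ffunP => s; rewrite ffunE; apply/eqP; have := f0 s;
      rewrite inE negbK.
  split; [apply/'forall_forallP => s t|apply/forallP => s];
    by rewrite !ffunE ?addr0 ?eqxx ?implybT.
- move=> f /dualP f_morph; apply/negbTE; rewrite negbK.
  have /eqP := f_morph 1%g 1%g.
  by rewrite mulg1 -[X in X == _]addr0 (inj_eq (addrI _)) eq_sym.
- move=> s _ /sgval1/(panticomm_stabilizer (subgP s))[E Es].
  apply: (sum_sign_eq0 (t := +%R (syn S E))) => [|f|f _].
  + exact: addrI.
  + apply/dualP/dualP => f_morph s' t'; last first.
      have /dualP/(_ s' t') := syn_dual E.
      by rewrite !ffunE addrACA -f_morph => ->.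
    have := f_morph s' t'; have /dualP/(_ s' t') := syn_dual E.
    by rewrite !ffunE => ->; rewrite addrACA; exact: addrI.
  + by rewrite ffunE F2_neq0D ffunE Es.
move=> f s /dualP f_morph _ fs; apply: (sum_sign_eq0 (t := mulg s)) => [|t|t _].
- exact: mulgI.
- by rewrite !inE.
by rewrite f_morph F2_neq0D fs.
Qed.

End Stabilizer.

Lemma card_logical_classes (n k : nat) (S L : {group pauli n}) :
    (k <= n)%N -> #|S| = (2 ^ (n - k))%N -> mI n \notin S ->
    ('C(S) = S * L)%g ->
  #|(zero_syndrome S L / stabilizers S)%g| = (4 ^ k)%N.
Proof.
move=> hkn hS hmI hSL; have := card_zero_syndrome hmI hSL.
(* As the image of a centralizer, this set is visibly a group, so Lagrange applies. *)
have -> : zero_syndrome S L = (pauli_pi_morphism n @* 'C(S))%g.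
  by rewrite /zero_syndrome hSL.
have TN : (stabilizers S \subset pauli_pi_morphism n @* 'C(S))%g.
  by rewrite morphimS // hSL mulG_subl.
rewrite -(Lagrange TN) -card_quotient ?pstr_norm // card_stabilizers //.
rewrite mulnA hS.
rewrite -expnD addnn -muln2 mulnC [(_ * 2)%N]mulnC expnM.
have -> : (4 ^ n = 4 ^ k * 4 ^ (n - k))%N by rewrite -expnD subnKC.
by move/eqP; rewrite eqn_pmul2r ?expn_gt0 // => /eqP.
Qed.

(** * Weight enumerators and the error distribution *)

Lemma wt_le (n : nat) (E : pstr n) : (wt E <= n)%N.
Proof. by rewrite -[leqRHS]card_ord max_card. Qed.

Section DDEnumerator.
Variables (R : realFieldType) (n : nat) (G : {set pstr n}) (p pDD : R).
Hypotheses (hp : 0 <= p < 1) (hDD : 0 <= pDD <= 1).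

Let z := p / (3 - 3 * p).

(** The bracket shared by all terms of both formulas: the unnormalized probability of [A], up to the
    factor (1 - p)^n. *)
Definition dd_enumerator (A : {set pstr n}) : R :=
  enumerator (A :&: unsuppressed G) z + pDD * enumerator (A :&: suppressed G) z.

Let z_ge0 : 0 <= z.
Proof. by rewrite /z; have /andP[? ?] := hp; apply: divr_ge0; lra. Qed.

(** Since p / 3 = (1 - p) z, the powers of 1 - p combine to the exponent n. *)
Lemma dd_weightE (E : pstr n) :
  dd_weight G p pDD E
    = (1 - p) ^+ n * (z ^+ wt E * (if E \in suppressed G then pDD else 1)).
Proof.
rewrite /dd_weight /depolarizing mulrA; congr (_ * _).
have -> : p / 3 = (1 - p) * z.
  by rewrite /z; field; rewrite subr_eq0 gt_eqF //; have /andP[_ p1] := hp; lra.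
by rewrite exprMn mulrA -exprD subnK ?wt_le.
Qed.

Lemma sum_dd_weight (A : {set pstr n}) :
  \sum_(E in A) dd_weight G p pDD E = (1 - p) ^+ n * dd_enumerator A.
Proof.
rewrite (big_setID (unsuppressed G)) /= mulrDr; congr (_ + _).
  rewrite mulr_sumr; apply: eq_bigr => E; rewrite inE => /andP[_ EU].
  by rewrite dd_weightE inE EU mulr1.
rewrite mulrCA mulr_sumr mulr_sumr -setDE; apply: eq_bigr => E.
by rewrite inE => /andP[EU _]; rewrite dd_weightE inE EU [RHS]mulrC -mulrA.
Qed.

Lemma dd_enumeratorID (A B : {set pstr n}) :
  dd_enumerator A = dd_enumerator (A :&: B) + dd_enumerator (A :\: B).
Proof.
rewrite /dd_enumerator /enumerator.
rewrite 2!(big_setID B (A := A :&: _)) /= mulrDr addrACA.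
by rewrite ![A :&: _ :&: B]setIAC ![(A :\: B) :&: _]setIDAC.
Qed.

(** The identity is unsuppressed and has weight 0, so it contributes 1 even when [z] or [pDD] is
    0. *)
Lemma dd_enumerator_gt0 (A : {set pstr n}) : 1%g \in A -> 0 < dd_enumerator A.
Proof.
move=> A1; have /andP[pDD0 _] := hDD; rewrite ltr_pwDl //.
  have U1 : 1%g \in A :&: unsuppressed G.
    rewrite !inE A1; apply/'forall_implyP => F _.
    by rewrite pcommE panticommC panticomm1r.
  rewrite /enumerator (bigD1 1%g) //= ltr_pwDl ?sumr_ge0 // => [|E _];
    last exact: exprn_ge0.
  rewrite /wt (eq_card0 (A := [set _ | _])) ?expr0 // => i.
  by rewrite !inE pstr1 eqxx.
by rewrite mulr_ge0 // sumr_ge0 // => E _; exact: exprn_ge0.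
Qed.

Lemma sum_dd_error (A : {set pstr n}) :
  \sum_(E in A) dd_error G p pDD E = dd_enumerator A / dd_enumerator setT.
Proof.
have p1 : (1 - p) ^+ n != 0.
  by rewrite expf_neq0 // subr_eq0 gt_eqF //; have /andP[] := hp.
rewrite -mulr_suml sum_dd_weight.
have -> : \sum_F dd_weight G p pDD F = (1 - p) ^+ n * dd_enumerator setT.
  by rewrite -sum_dd_weight; apply: eq_bigl => E; rewrite inE.
by rewrite invfM mulrACA divff // mul1r.
Qed.

End DDEnumerator.

(** * Probabilities of the events of a run *)

Lemma sum_uniform_eq (R : fieldType) (T : finType) (A : {set T}) (y : T) :
  \sum_x uniform R A x * (x == y)%:R = uniform R A y.
Proof.
rewrite (bigD1 y) //= eqxx mulr1 big1 ?addr0 // => x /negPf ->.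
by rewrite mulr0.
Qed.

Lemma sum_uniform (R : numFieldType) (T : finType) (A : {set T}) (x0 : T) :
  x0 \in A -> \sum_x uniform R A x = 1.
Proof.
move=> Ax0; rewrite -big_mkcond sumr_const -[LHS]mulr_natl divff //.
by rewrite pnatr_eq0 -lt0n; apply/card_gt0P; exists x0.
Qed.

Section Run.
Variables (R : realFieldType) (n : nat) (S L : {group pauli n}).
Variables (G : {set pstr n}) (p pDD pQED : R).
Hypothesis hSL : ('C(S) = S * L)%g.

Let T := stabilizers S.
Let N := zero_syndrome S L.

(* The draws of the syndrome report and of the class are independent given the
   error, so events of product form factor. *)
Lemma prob_hyb_law (B : {pred run S})
    (a : pstr n -> bool -> syndromes S -> bool)
    (d : pstr n -> coset_of T -> bool) :
    (forall E b f c, ((E, b, f, c) \in B) = d E c && a E b f) ->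
  prob (hyb_law L G p pDD pQED) B
    = \sum_E dd_error G p pDD E
        * (\sum_b bernoulli pQED b * \sum_f uniform R (dual S) f * (a E b f)%:R)
        * (\sum_c uniform R (N / T)%g c * (d E c)%:R).
Proof.
move=> Bad; rewrite /prob big_mkcond /=.
pose h E b f c :=
  if (E, b, f, c) \in B then hyb_law L G p pDD pQED (E, b, f, c) else 0.
transitivity (\sum_E \sum_b \sum_f \sum_c h E b f c).
  by rewrite pair_bigA pair_bigA pair_bigA; apply: eq_bigr => -[[[E b] f] c] _.
apply: eq_bigr => E _; rewrite mulrAC mulr_sumr; apply: eq_bigr => b _.
rewrite mulrA mulr_sumr; apply: eq_bigr => f _.
rewrite mulr_sumr !mulr_suml; apply: eq_bigr => c _.
by rewrite /h /hyb_law Bad; case: (d E c); case: (a E b f); rewrite /=; ring.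
Qed.

Let dual0 : 0 \in dual S.
Proof. by rewrite inE; apply/'forall_forallP => s t; rewrite !ffunE addr0. Qed.

Let class1 : 1%g \in (N / T)%g.
Proof. by rewrite /N /zero_syndrome -hSL group1. Qed.

Let uniform_dual0 : uniform R (dual S) 0 = #|dual S|%:R^-1.
Proof. by rewrite /uniform dual0. Qed.

Let uniform_class1 : uniform R (N / T)%g 1%g = #|(N / T)%g|%:R^-1.
Proof. by rewrite /uniform class1. Qed.

Let sub_TN : T \subset N.
Proof. by rewrite morphimS // mulG_subl. Qed.

(** A true report vanishes exactly when [E] is in [N]; a faulty one hits the single value 0 of the
    dual. *)
Lemma prob_reported0 (E : pstr n) :
  \sum_b bernoulli pQED b * \sum_f uniform R (dual S) f
      * ((if b then f else syn S E) == 0)%:R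
    = (1 - pQED) * (E \in N)%:R + #|dual S|%:R^-1 * pQED.
Proof.
rewrite big_bool /= sum_uniform_eq uniform_dual0 -mulr_suml.
by rewrite (sum_uniform _ dual0) mul1r (syn_eq0 _ hSL) addrC [pQED * _]mulrC.
Qed.

Lemma P_A_HybE :
  P_A_Hyb S L G p pDD pQED
    = (1 - pQED) * \sum_(E in N) dd_error G p pDD E
      + #|dual S|%:R^-1 * pQED * \sum_E dd_error G p pDD E.
Proof.
rewrite /P_A_Hyb (prob_hyb_law
  (a := fun E b f => (if b then f else syn S E) == 0)
  (d := fun _ _ => true)) //.
rewrite [in RHS]big_mkcond /= !mulr_sumr -big_split /=.
apply: eq_bigr => E _; rewrite prob_reported0 -mulr_suml (sum_uniform _ class1).
by case: (E \in N) => /=; ring.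
Qed.

Lemma prob_logical_class_eq1 (E : pstr n) :
  \sum_c uniform R (N / T)%g c
      * ((if E \in N then coset T E else c) == 1%g)%:R
    = if E \in N then (E \in T)%:R else #|(N / T)%g|%:R^-1.
Proof.
case: ifP => EN; last by rewrite sum_uniform_eq uniform_class1.
rewrite -mulr_suml (sum_uniform _ class1) mul1r; congr (nat_of_bool _)%:R.
have ET : E \in 'N(T)%g by rewrite (subsetP (pstr_norm setT T)) ?inE.
by apply/eqP/idP => [/coset_idr->|/coset_id].
Qed.

(** Errors in [T] are accepted under a true report or a faulty zero report; errors in [N] outside
    [T] never count; errors outside [N] need a faulty zero report and a lucky class. *)
Lemma prob_trivial_accepted :
  prob (hyb_law L G p pDD pQED)
      [predI @logically_trivial n S L & @accepted n S]
    = (1 - pQED + #|dual S|%:R^-1 * pQED) * \sum_(E in T) dd_error G p pDD E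
      + #|(N / T)%g|%:R^-1 * #|dual S|%:R^-1 * pQED
        * \sum_(E in ~: N) dd_error G p pDD E.
Proof.
rewrite (prob_hyb_law (a := fun E b f => (if b then f else syn S E) == 0)
  (d := fun E c => (if E \in N then coset T E else c) == 1%g)) //.
rewrite [in RHS]big_mkcond [X in _ + _ * X]big_mkcond /=.
rewrite !mulr_sumr -big_split /=.
apply: eq_bigr => E _; rewrite prob_reported0 prob_logical_class_eq1 inE.
case: ifP => EN; first by case: (E \in T); rewrite /=; ring.
by rewrite (contraFF (subsetP sub_TN E) EN) /=; ring.
Qed.

End Run.

(** * The infidelity and acceptance formulas *)

Theorem lemma6 (R : realFieldType) (n k : nat) (S L : {group pauli n})
    (G : {group pstr n}) (p pDD pQED : R)
    (hk1 : (1 <= k)%N) (hkn : (k <= n)%N)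
    (hS : #|S| = (2 ^ (n - k))%N) (hmI : mI n \notin S)
    (hL : (L \subset 'C(S))%g) (hSL : ('C(S) = S * L)%g)
    (hST : ((pauli_pi_morphism n @* S) :&: (pauli_pi_morphism n @* L) = 1)%g)
    (hG : (G :!=: 1)%g)
    (hp : 0 <= p < 1) (hDD : 0 <= pDD <= 1) (hQED : 0 <= pQED <= 1) :
  let z := p / (3 - 3 * p) in
  let W := fun A : {set pstr n} => enumerator A z in
  let T := stabilizers S in
  let N := zero_syndrome S L in
  let U := unsuppressed G in
  let V := suppressed G in
  let Q := (1 - pQED) * (W (N :&: U) + pDD * W (N :&: V))
           + 2 ^ (k%:Z - n%:Z) * pQED * (W U + pDD * W V) in
  1 - F_HybD S L G p pDD pQED
    = Q^-1 * ((1 - pQED * (1 - 2 ^ (k%:Z - n%:Z)))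
                * (W ((N :\: T) :&: U) + pDD * W ((N :\: T) :&: V))
              + (1 - 4 ^- k) * 2 ^ (k%:Z - n%:Z) * pQED
                * (W (U :\: N) + pDD * W (V :\: N)))
  /\ P_A_Hyb S L G p pDD pQED = Q / (W U + pDD * W V).
Proof.
move=> z W T N U V Q.
pose m := dd_enumerator G p pDD.
have card_dual_inv : #|dual S|%:R^-1 = 2 ^ (k%:Z - n%:Z) :> R.
  by rewrite card_dual // hS natrX -opprB subzn // exprnN.
have mT : m setT = W U + pDD * W V by rewrite /m /dd_enumerator !setTI.
have mNC : m (~: N) = W (U :\: N) + pDD * W (V :\: N).
  by rewrite /m /dd_enumerator ![~: N :&: _]setIC -!setDE.
have TN : T \subset N by rewrite morphimS // mulG_subl.
have m_split : m setT = m N + m (~: N).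
  by rewrite /m (dd_enumeratorID _ _ _ _ N) setTI setTD.
have mN_split : m N = m T + m (N :\: T).
  by rewrite /m (dd_enumeratorID _ _ _ _ T) (setIidPr TN).
have mT_gt0 : 0 < m setT by rewrite dd_enumerator_gt0 ?inE.
have mN_gt0 : 0 < m N.
  by rewrite dd_enumerator_gt0 // /N /zero_syndrome -hSL group1.
set r : R := 2 ^ _ in Q card_dual_inv *.
have r_gt0 : 0 < r by exact: exprz_gt0.
have QE : Q = (1 - pQED) * m N + r * pQED * m setT by rewrite mT.
(* [Q] is a convex combination, with weights 1 - pQED and pQED, of the positive numbers [m N] and
   [r * m setT]. *)
have Q_gt0 : 0 < Q.
  have /andP[q0 q1] := hQED; have rmT_gt0 := mulr_gt0 r_gt0 mT_gt0.
  by rewrite QE mulrAC; move: (r * m _) rmT_gt0 => rmT rmT_gt0; nra.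
have PA : P_A_Hyb S L G p pDD pQED = Q / m setT.
  rewrite P_A_HybE // card_dual_inv.
  have -> : \sum_E dd_error G p pDD E = m setT / m setT.
    by rewrite -sum_dd_error //; apply: eq_bigl => E; rewrite inE.
  by rewrite sum_dd_error // -/N -/m QE; field; rewrite gt_eqF.
split; last by rewrite -mT.
rewrite /F_HybD /cond_prob prob_trivial_accepted //.
rewrite -/(P_A_Hyb S L G p pDD pQED).
rewrite PA card_dual_inv (card_logical_classes hkn) //.
rewrite !sum_dd_error // -mNC -/T -/N -/m.
rewrite -[W (_ :&: _) + _]/(m (N :\: T)) natrX.
(* The normalization [m setT] cancels in the conditional probability. Splitting [Q] over [T],
   [N :\: T] and [~: N] then cancels the [T] term and leaves the factor 1 - 4^-k on [~: N]. *)
transitivity (Q^-1 * (Q - ((1 - pQED + r * pQED) * m T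
                           + 4 ^- k * r * pQED * m (~: N)))).
  by field; rewrite !gt_eqF // exprn_gt0.
by congr (_ * _); rewrite QE m_split mN_split; ring.
Qed.
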